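(* Let $G_1$ be an $r_1$-regular graph with $n_1$ vertices and $m_1$ edges and let $G_2$ be an arbitrary graph with $n_2$ vertices. Then the signless Laplacian characteristic polynomial of the central edge corona $G_1\underline{\odot}G_2$ is (as an identity of rational functions in $x$) $$\begin{aligned}f(Q(G_1\underline{\odot}G_2),x)=\;&\big(x-n_2-2-\chi_{Q(G_2)}(x-1)\big)^{m_1-n_1}\prod_{j=1}^{n_2}\big(x-1-\gamma_j(G_2)\big)^{m_1}\\&\times\prod_{i=1}^{n_1}\Big[(x-n_1+2)\big(x-n_2-2-\chi_{Q(G_2)}(x-1)\big)-r_1-\big(x-n_2-2-\chi_{Q(G_2)}(x-1)\big)P(\lambda_i(G_1))\\&\qquad+\big(x-n_2-3-\chi_{Q(G_2)}(x-1)\big)\lambda_i(G_1)\Big].\end{aligned}$$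
   Context: All graphs are finite, simple and connected. For a graph $G$ on $n$ vertices, $A(G)$ is its adjacency matrix with eigenvalues $\lambda_1(G)\ge\dots\ge\lambda_n(G)$; $D(G)$ is the diagonal matrix of vertex degrees; $Q(G)=D(G)+A(G)$ is the signless Laplacian matrix with eigenvalues $\gamma_1(G)\ge\gamma_2(G)\ge\dots\ge\gamma_n(G)$. For an $n\times n$ matrix $M$, $f(M,x)=\det(xI_n-M)$, and $\chi_M(x)=\mathbf 1^T(xI_n-M)^{-1}\mathbf 1$ is the sum of all entries of $(xI_n-M)^{-1}$ (the $M$-coronal); $\chi_{Q(G_2)}(x-1)$ is this function evaluated at $x-1$. $P$ denotes the polynomial associated with $G_1$: if $G_1$ is connected $r_1$-regular on $n_1$ vertices with distinct adjacency eigenvalues $r_1=\theta_1,\theta_2,\dots,\theta_t$, then $P(x)=n_1\prod_{k=2}^t\frac{x-\theta_k}{r_1-\theta_k}$; thus $P(A(G_1))$ is the all-ones matrix, $P(r_1)=n_1$ and $P(\theta_k)=0$ for $k\ge2$. The central graph $C(G)$ of $G$ is obtained from $G$ by subdividing each edge of $G$ exactly once and joining all pairs of distinct vertices of $G$ that are nonadjacent in $G$; $\tilde V(G)=V(C(G))\setminus V(G)$ is the set of subdivision vertices, corresponding to the edges of $G$. The central edge corona $G_1\underline{\odot}G_2$ is obtained by taking $C(G_1)$ and $|\tilde V(G_1)|$ copies of $G_2$, and joining the $i$-th vertex of $\tilde V(G_1)$ to every vertex in the $i$-th copy of $G_2$, for each $i$. *)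

(* Defs.v *)
From mathcomp Require Import all_boot all_order all_algebra.
From mathcomp Require Import polyrcf.
From mathcomp Require Import reals.

Set Implicit Arguments.
Unset Strict Implicit.
Unset Printing Implicit Defensive.

Import Order.TTheory GRing.Theory Num.Theory.
Local Open Scope ring_scope.

Record sgraph := SGraph {
  vertex :> finType;
  adj : rel vertex;
  adj_sym : symmetric adj;
  adj_irr : irreflexive adj }.

(* The one-vertex graph is connected, the graph with no vertex is not. *)
Definition connected (G : sgraph) : Prop :=
  (0 < #|G|)%N /\ forall u v : G, connect (@adj G) u v.

Definition deg (G : sgraph) (v : G) : nat := #|[set w | adj v w]|.

Definition regular (r : nat) (G : sgraph) : Prop := forall v : G, deg v = r.

Definition edges (G : sgraph) : {set {set G}} :=
  [set e : {set G} | [exists u, exists v, adj u v && (e == [set u; v])]].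

Notation edge G := {e : {set vertex G} | e \in edges G}.

Section CentralGraph.
Variable G : sgraph.

(* [inr e] is the vertex subdividing the edge [e]. *)
Definition central_adj (x y : G + edge G) : bool :=
  match x, y with
  | inl u, inl v => (u != v) && ~~ adj u v
  | inl u, inr e => u \in val e
  | inr e, inl u => u \in val e
  | inr _, inr _ => false
  end.

Lemma central_adj_sym : symmetric central_adj.
Proof. by move=> [u|e] [v|f] //=; rewrite eq_sym adj_sym. Qed.

Lemma central_adj_irr : irreflexive central_adj.
Proof. by move=> [u|e] //=; rewrite eqxx. Qed.

Definition central_graph : sgraph := SGraph central_adj_sym central_adj_irr.

End CentralGraph.

Section CentralEdgeCorona.
Variables G1 G2 : sgraph.

(* [inr (e, w)] is the vertex [w] in the copy of [G2] attached to the
   subdivision vertex [inl (inr e)]. *)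
Definition corona_adj (x y : central_graph G1 + edge G1 * G2) : bool :=
  match x, y with
  | inl a, inl b => adj a b
  | inl a, inr (e, _) => a == inr e
  | inr (e, _), inl a => a == inr e
  | inr (e, v), inr (f, w) => (e == f) && adj v w
  end.

Lemma corona_adj_sym : symmetric corona_adj.
Proof.
move=> [a|[e v]] [b|[f w]]; rewrite /corona_adj //; first exact: adj_sym.
by rewrite eq_sym adj_sym.
Qed.

Lemma corona_adj_irr : irreflexive corona_adj.
Proof.
move=> [a|[e v]]; rewrite /corona_adj; first exact: adj_irr.
by rewrite adj_irr andbF.
Qed.

Definition central_edge_corona : sgraph := SGraph corona_adj_sym corona_adj_irr.

End CentralEdgeCorona.

Section GraphMatrices.
Variables (R : realType) (G : sgraph).

Definition adjacency_mx : 'M[R]_#|G| :=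
  \matrix_(i, j) (adj (enum_val i) (enum_val j))%:R.

Definition degree_mx : 'M[R]_#|G| := diag_mx (\row_i (deg (enum_val i))%:R).

Definition signless_laplacian : 'M[R]_#|G| := degree_mx + adjacency_mx.

End GraphMatrices.

Section Spectrum.
Variables (R : realType) (n : nat).
Implicit Type M : 'M[R]_n.

(* The real roots of the characteristic polynomial in decreasing order, each
   repeated according to its multiplicity ([rootsR] is increasing and without
   repetition). *)
Definition eigenvalues M : seq R :=
  rev (flatten [seq nseq (mup a (char_poly M)) a | a <- rootsR (char_poly M)]).

(* Indexed from 0, so the largest eigenvalue is [eigenvalue_at M 0]. *)
Definition eigenvalue_at M (i : nat) : R := (eigenvalues M)`_i.

Definition distinct_eigenvalues M : seq R := undup (eigenvalues M).

End Spectrum.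

(* The product ranges over the distinct adjacency eigenvalues other than [r],
   which is the largest one when [G] is [r]-regular. *)
Definition regular_poly (R : realType) (G : sgraph) (r : nat) : {poly R} :=
  #|G|%:R%:P *
  \prod_(t <- distinct_eigenvalues (adjacency_mx R G) | t != r%:R)
    ((r%:R - t)^-1 *: ('X - t%:P)).

Notation ratfun R := {fraction {poly R}}.

Definition const_ratfun (R : realType) (a : R) : ratfun R :=
  tofrac a%:P.

Definition varX (R : realType) : ratfun R := tofrac 'X.

Definition coronal (R : realType) n (M : 'M[R]_n) (y : ratfun R) : ratfun R :=
  ((const_mx 1 : 'rV_n) *m invmx (y%:M - map_mx (@const_ratfun R) M)
     *m (const_mx 1 : 'cV_n)) 0 0.

(* Main.v *)
Require Import Defs.
From HB Require Import structures.
From mathcomp Require Import all_boot all_order all_algebra.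
From mathcomp Require Import reals.
From mathcomp Require Import ring.
From mathcomp Require Import perm polyrcf complex.

Set Implicit Arguments.
Unset Strict Implicit.
Unset Printing Implicit Defensive.

Import Order.TTheory GRing.Theory Num.Theory.
Local Open Scope ring_scope.

(** The proof computes the determinant of [x I - Q], where [Q] is the signless
Laplacian of the corona, over the field of rational functions, by two Schur
complements.

In the corona a vertex of [G1] has degree [n1 - 1], a subdivision vertex has
degree [n2 + 2], and a vertex [v] of a copy of [G2] has degree [deg v + 1].
The copies of [G2] form a block diagonal matrix with [m1] blocks
[N = (x - 1) I - Q(G2)]; eliminating them ([det_eliminate_copies]) contributes
[(\det N)^m1] and turns the diagonal entry of every subdivision vertex into
[s = x - n2 - 2 - chi(x - 1)], because a subdivision vertex sees its copy only
through the sum of the entries of [N^-1].  The subdivision vertices are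
pairwise nonadjacent, so they now form the scalar block [s I]; eliminating them
([det_eliminate_subdivision]) contributes [s^m1].  If [B] is the vertex-edge
incidence matrix then [B B^T = r1 I + A] ([sum_incidence]), so what remains
on [G1] is the determinant of
[(x - n1 + 2 - r1 / s) I + (1 - 1 / s) A - J], with [J] the all-ones matrix.

The matrix [A] is real symmetric, hence diagonalizable over the reals
([real_symmetric_diag]), and [J = P(A)] when [G1] is connected and regular
([regular_poly_adjacency]), so [I], [A] and [J] are diagonalized together and
the determinant is a product over the eigenvalues of [A]
([det_simultaneous_diag], [prod_eigenvalues]).  Distributing [s^n1] over the
[n1] factors gives the formula.

The divisions by [s] require [s <> 0] ([subdivision_entry_neq0]): the product of [s] and
[\det N] is the characteristic polynomial of the matrix [Q(G2) + I] bordered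
by ones and a corner entry [n2 + 2], which is monic. *)

(** * Diagonalization of real symmetric matrices *)

(** The spectral theorem for real symmetric matrices.  It is transferred from
the complex numbers: the complex spectral theorem gives a real diagonal matrix,
and two real matrices that are similar over the complex numbers are similar
over the reals. *)
Lemma real_symmetric_diag (R : rcfType) n (M : 'M[R]_n) : M^T = M ->
  exists S : 'M[R]_n, exists d : 'rV[R]_n,
    S \in unitmx /\ M = invmx S *m diag_mx d *m S.
Proof.
move=> symM; pose toC := real_complex R; pose MC := map_mx toC M.
have realC m p (B : 'M[R]_(m, p)) : map_mx toC B \is a mxOver Num.real.
  by apply/mxOverP => i j; rewrite mxE; apply/complex_realP; eexists.
have hermM : MC \is hermsymmx.
  apply: realsym_hermsym (realC _ _ _).
  by apply/is_hermitianmxP; rewrite expr0 scale1r map_mx_id // /MC -{1}symM map_trmx.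
have := hermitian_normalmx hermM => /orthomx_spectralP eM.
have := hermitian_spectral_diag_real hermM => /mxOverP dreal.
pose d : 'rV[R]_n := map_mx (@complex.Re R) (spectral_diag MC).
have ed : map_mx toC d = spectral_diag MC.
  by apply/rowP => j; rewrite !mxE; exact: RRe_real.
have simM : similar_in unitmx MC (map_mx toC (diag_mx d)).
  exists (spectralmx MC); first exact: spectral_unit.
  rewrite map_diag_mx ed; apply/similarP; first exact: spectral_unit.
  by rewrite {2}eM !mulmxA mulmxV ?mul1mx ?spectral_unit.
have [P] := real_similar simM (realC _ _ _) (realC _ _ _).
rewrite inE => /andP[/mxOverP realP unitP] /(similarP unitP) eP.
pose S : 'M[R]_n := map_mx (@complex.Re R) P.
have eS : map_mx toC S = P by apply/matrixP => i j; rewrite !mxE; exact: RRe_real.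
have unitS : S \in unitmx by rewrite -(map_unitmx toC) eS.
exists S, d; split => //; rewrite -mulmxA.
apply: (canRL (mulKmx unitS)); apply: (map_mx_inj (f := toC)).
by rewrite !map_mxM eS.
Qed.

Lemma det_simultaneous_diag (F : fieldType) (K : comNzRingType)
    (f : {rmorphism F -> K}) n (S : 'M[F]_n) (d e : 'rV[F]_n) (a b c : K) :
  S \in unitmx ->
  \det (a%:M + b *: map_mx f (invmx S *m diag_mx d *m S)
             + c *: map_mx f (invmx S *m diag_mx e *m S)) =
  \prod_i (a + b * f (d 0 i) + c * f (e 0 i)).
Proof.
move=> uS; set T := map_mx f (invmx S); set U := map_mx f S.
have TU : T *m U = 1%:M by rewrite -map_mxM mulVmx // map_mx1.
pose v : 'rV[K]_n := \row_i (a + b * f (d 0 i) + c * f (e 0 i)).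
rewrite [X in \det X](_ : _ = T *m diag_mx v *m U); last first.
  have -> : diag_mx v = a%:M + b *: map_mx f (diag_mx d) + c *: map_mx f (diag_mx e).
    apply/matrixP => i j; rewrite !mxE; case: (i == j); rewrite ?mulr1n //.
    by rewrite !mulr0n rmorph0 !mulr0 !addr0.
  rewrite !mulmxDr !mulmxDl -!scalemxAr -!scalemxAl !map_mxM -/T -/U.
  by rewrite mul_mx_scalar -scalemxAl TU scalemx1.
rewrite !det_mulmx mulrAC -det_mulmx TU det1 mul1r det_diag.
by apply: eq_bigr => i _; rewrite mxE.
Qed.

(** For a diagonalizable matrix, the list of the real roots of the
characteristic polynomial with multiplicities is, up to order, the diagonal of
any diagonal form; in particular all eigenvalues are real. *)
Lemma eigenvalues_perm (R : realType) n (S : 'M[R]_n) (d : 'rV[R]_n) :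
  S \in unitmx ->
  perm_eq (eigenvalues (invmx S *m diag_mx d *m S)) [seq d 0 i | i <- enum 'I_n].
Proof.
move=> uS; set M := _ *m S.
have charE : char_poly M = \prod_(t <- [seq d 0 i | i <- enum 'I_n]) ('X - t%:P).
  have := det_simultaneous_diag (@polyC R) d d 'X (-1) 0 uS.
  rewrite scale0r addr0 scaleN1r -/M /char_poly => ->.
  by rewrite big_image; apply: eq_bigr => i _; rewrite mulN1r mul0r addr0.
rewrite /eigenvalues; set p := char_poly M in charE *.
have p0 : p != 0 by rewrite monic_neq0 ?char_poly_monic.
rewrite (perm_trans (permEl (perm_rev _))) //.
apply/allP => t _ /=; apply/eqP; rewrite -[RHS]mu_prod_XsubC -charE.
rewrite count_flatten -map_comp sumnE big_map.
have inR a : (a \in rootsR p) = root p a.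
  by rewrite -roots_on_rootsR //; rewrite inE.
have [rt|nrt] := boolP (root p t); last first.
  rewrite mupNroot // big1_seq // => a /andP[_]; rewrite inR => ra /=.
  rewrite count_nseq /=; case: eqP => [eat|]; last by rewrite mul0n.
  by rewrite -eat ra in nrt.
rewrite (bigD1_seq t) /= ?inR ?uniq_roots // count_nseq /= eqxx mul1n.
rewrite big1 ?addn0 // => a /negPf nat.
by rewrite count_nseq /= nat mul0n.
Qed.

Lemma prod_eigenvalues (R : realType) (K : comNzRingType) n (S : 'M[R]_n)
    (d : 'rV[R]_n) (F : R -> K) :
  S \in unitmx ->
  \prod_(i < n) F (eigenvalue_at (invmx S *m diag_mx d *m S) i) =
  \prod_i F (d 0 i).
Proof.
move=> uS; have pe := eigenvalues_perm d uS.
have -> : \prod_i F (d 0 i) = \prod_(t <- [seq d 0 i | i <- enum 'I_n]) F t.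
  by rewrite big_image.
rewrite -(perm_big _ pe) /=.
have := perm_size pe; rewrite size_map size_enum_ord => szn.
by rewrite (big_nth 0) szn big_mkord.
Qed.

(** * The polynomial of a connected regular graph *)

(** The discrete maximum principle: at a maximum of [f] the neighbours must
attain the same value, and connectedness propagates the maximum. *)
Lemma harmonic_constant (R : realType) (G : sgraph) (f : G -> R) :
  connected G ->
  (forall u, \sum_(w | adj u w) f w = (deg u)%:R * f u) ->
  forall u v, f u = f v.
Proof.
move=> [_ conG] harm.
have [u0|//] := pickP (fun _ : G => true); last first.
  by move=> noG u v; have := noG u.
move=> _; have [um _ fmax] := @arg_maxP _ _ _ u0 predT f isT.
have {}fmax w : f w <= f um by exact: fmax.
have step v w : adj v w -> f v = f um -> f w = f um.
  move=> vw fv; apply/eqP; rewrite eq_le fmax //= -subr_le0.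
  have /eqP : \sum_(t | adj v t) (f um - f t) = 0.
    by rewrite sumrB harm sumr_const fv /deg cardsE mulr_natl subrr.
  rewrite psumr_eq0 => [/allP/(_ w (mem_index_enum w))|t _].
    by rewrite vw /= => /eqP->.
  by rewrite subr_ge0 fmax.
have walk s v : path (@adj G) v s -> f v = f um -> f (last v s) = f um.
  elim: s v => //= w s IH v /andP[vw ps] fv.
  by apply: IH ps _; apply: step vw fv.
have allm v : f v = f um by have /connectP[s ps ->] := conG um v; apply: walk.
by move=> u v; rewrite !allm.
Qed.

Section RegularPolynomial.
Variables (R : realType) (G : sgraph) (r : nat).
Hypotheses (conG : connected G) (regG : regular r G).
Local Notation A := (adjacency_mx R G).

Lemma adjacency_mx_sym : A^T = A.
Proof. by apply/matrixP => i j; rewrite !mxE adj_sym. Qed.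

Lemma adjacency_mx_mulE p (B : 'M[R]_(#|G|, p)) i j :
  (A *m B) i j = \sum_(w | adj (enum_val i) w) B (enum_rank w) j.
Proof.
rewrite mxE (reindex_onto enum_rank enum_val) /=; last by move=> k _; rewrite enum_valK.
under eq_bigl do rewrite enum_rankK eqxx.
rewrite [RHS]big_mkcond; apply: eq_bigr => w _.
by rewrite mxE enum_rankK; case: adj; rewrite ?mul1r ?mul0r.
Qed.

(** The eigenspace of the valency [r] of a connected regular graph consists of
the constant vectors. *)
Lemma adjacency_mx_kernel p (B : 'M[R]_(#|G|, p)) i i' j :
  A *m B = r%:R *: B -> B i j = B i' j.
Proof.
move=> AB; rewrite -(enum_valK i) -(enum_valK i').
apply: (harmonic_constant conG (f := fun u => B (enum_rank u) j)) => u.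
rewrite -{1}(enum_rankK u) -adjacency_mx_mulE AB mxE.
by rewrite regG.
Qed.

Lemma adjacency_mx_ones p : A *m const_mx 1 = r%:R *: const_mx 1 :> 'M[R]_(#|G|, p).
Proof.
apply/matrixP => i j; rewrite adjacency_mx_mulE !mxE mulr1.
under eq_bigr do rewrite mxE.
by rewrite sumr_const -(regG (enum_val i)) /deg cardsE.
Qed.

Lemma regular_poly_degree : (regular_poly R G r).[r%:R] = #|G|%:R.
Proof.
rewrite /regular_poly hornerM hornerC horner_prod big1 ?mulr1 // => t nt.
by rewrite hornerZ hornerXsubC mulVf // subr_eq0 eq_sym.
Qed.

Lemma regular_poly_eigenvalue t :
  t \in eigenvalues A -> t != r%:R -> (regular_poly R G r).[t] = 0.
Proof.
move=> tA nt; apply/eqP; rewrite /regular_poly hornerM mulf_eq0; apply/orP; right.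
rewrite horner_prod (big_rem t) /=; last by rewrite mem_undup.
by rewrite nt hornerZ hornerXsubC subrr mulr0 mul0r.
Qed.

(** Given a diagonalization [A = S^-1 D S], the left-hand side is [P(A)].  The
polynomial [(X - r) P] vanishes at all eigenvalues of [A], so the rows and the
columns of [P(A)] lie in the eigenspace of [r] and all entries of [P(A)] are
equal; as [P(r) = n], the all-ones vector fixes the common value to 1. *)
Lemma regular_poly_adjacency (S : 'M[R]_#|G|) (d : 'rV[R]_#|G|) :
  S \in unitmx -> A = invmx S *m diag_mx d *m S ->
  invmx S *m diag_mx (map_mx (horner (regular_poly R G r)) d) *m S = const_mx 1.
Proof.
move=> uS eA; set P := regular_poly R G r; set e := map_mx _ d; set Z := _ *m S.
have /perm_mem pe := eigenvalues_perm d uS; rewrite -eA in pe.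
have d_or i : (d 0 i - r%:R) * e 0 i = 0.
  rewrite mxE; have [->|ne] := eqVneq (d 0 i) r%:R; first by rewrite subrr mul0r.
  rewrite regular_poly_eigenvalue ?mulr0 // pe; apply/mapP; exists i => //.
  by rewrite mem_enum.
have de : diag_mx d *m diag_mx e = r%:R *: diag_mx e.
  rewrite mulmx_diag; apply/matrixP => i j; rewrite !mxE.
  case: (i == j); rewrite ?mulr0n ?mulr0 // !mulr1n.
  by apply/eqP; rewrite -subr_eq0 -mulrBl; have := d_or i; rewrite mxE => ->.
have AZ : A *m Z = r%:R *: Z.
  by rewrite eA /Z -!mulmxA mulKVmx // (mulmxA (diag_mx d)) de -scalemxAl -scalemxAr.
have ZA : A *m Z^T = r%:R *: Z^T.
  rewrite -adjacency_mx_sym -trmx_mul -linearZ; congr trmx.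
  rewrite eA /Z -!mulmxA mulKVmx // (mulmxA (diag_mx e)) diag_mxC de.
  by rewrite -scalemxAl -scalemxAr.
have Zconst i j i' j' : Z i j = Z i' j'.
  rewrite (adjacency_mx_kernel i i' j AZ).
  by have := adjacency_mx_kernel j j' i' ZA; rewrite !mxE.
pose o : 'cV[R]_#|G| := const_mx 1.
have So : diag_mx e *m (S *m o) = #|G|%:R *: (S *m o).
  have : diag_mx d *m (S *m o) = r%:R *: (S *m o).
    have := adjacency_mx_ones 1; rewrite eA -!mulmxA => /(congr1 (mulmx S)).
    by rewrite mulKVmx // -scalemxAr.
  move=> /matrixP dS; apply/matrixP => i j; have := dS i j.
  rewrite !mul_diag_mx !mxE; set y := \sum__ _ => dy.
  have [->|ne] := eqVneq (d 0 i) r%:R; first by rewrite regular_poly_degree.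
  have /eqP : (d 0 i - r%:R) * y = 0 by rewrite mulrBl dy subrr.
  by rewrite mulf_eq0 subr_eq0 (negPf ne) /= => /eqP->; rewrite !mulr0.
have Zo : Z *m o = #|G|%:R *: o.
  by rewrite /Z -!mulmxA So -scalemxAr mulKmx.
apply/matrixP => i j; rewrite [RHS]mxE.
have G0 : #|G|%:R != 0 :> R by rewrite pnatr_eq0 -lt0n; case: conG.
have /matrixP/(_ i 0) := Zo; rewrite mxE [RHS]mxE mxE mulr1.
under eq_bigr => k _ do rewrite [o k 0]mxE mulr1 (Zconst i k i j).
rewrite sumr_const card_ord => eZ.
by apply: (mulIf G0); rewrite mul1r mulr_natr.
Qed.

End RegularPolynomial.

(** * Determinants of matrices indexed by finite types *)

Section FinMatrix.
Variable K : comNzRingType.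

(** The matrix with rows and columns indexed by finite types, along their
standard enumerations.  Its determinant, for [T = U], does not depend on the
enumeration ([det_finmx_ord]), so vertex sets can be split as sum and product
types. *)
Definition finmx (T U : finType) (F : T -> U -> K) : 'M[K]_(#|T|, #|U|) :=
  \matrix_(i, j) F (enum_val i) (enum_val j).

Lemma eq_finmx (T U : finType) (F F' : T -> U -> K) : F =2 F' -> finmx F = finmx F'.
Proof. by move=> eF; apply/matrixP => i j; rewrite !mxE eF. Qed.

Lemma det_finmx_ord n (T : finType) (h : 'I_n -> T) (F : T -> T -> K) :
  bijective h -> \det (\matrix_(i, j) F (h i) (h j)) = \det (finmx F).
Proof.
move=> bij_h; have := bij_eq_card bij_h; rewrite card_ord => en.
subst n; have inj : injective (enum_rank \o h).
  exact: inj_comp enum_rank_inj (bij_inj bij_h).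
rewrite [X in \det X](_ : _ = row_perm (perm inj) (col_perm (perm inj) (finmx F))).
  rewrite row_permE col_permE !det_mulmx !det_perm mulrCA.
  by rewrite odd_permV -expr2 sqrr_sign mulr1.
by apply/matrixP => i j; rewrite !mxE !permE /= !enum_rankK.
Qed.

Lemma det_finmx_bij (T U : finType) (h : T -> U) (F : U -> U -> K) :
  bijective h -> \det (finmx (fun s t => F (h s) (h t))) = \det (finmx F).
Proof.
move=> bij_h; have bij_he : bijective (h \o @enum_val T T).
  exact: bij_comp bij_h (enum_val_bij T).
by rewrite -(det_finmx_ord F bij_he).
Qed.

Lemma det_finmx_sum (A B : finType) (F : A + B -> A + B -> K) :
  \det (finmx F) =
  \det (block_mx (finmx (fun a a' => F (inl a) (inl a')))
                 (finmx (fun a b => F (inl a) (inr b)))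
                 (finmx (fun b a => F (inr b) (inl a)))
                 (finmx (fun b b' => F (inr b) (inr b')))).
Proof.
pose h (i : 'I_(#|A| + #|B|)) : A + B :=
  match split i with inl j => inl (enum_val j) | inr k => inr (enum_val k) end.
rewrite -(det_finmx_ord (h := h)); last first.
  exists (fun s => match s with inl a => lshift _ (enum_rank a)
                            | inr b => rshift _ (enum_rank b) end).
    by rewrite /h => i; case: splitP => j ei; apply: val_inj; rewrite /= enum_valK ei.
  rewrite /h; case=> t.
    by rewrite (unsplitK (inl _ _)) enum_rankK.
  by rewrite (unsplitK (inr _ _)) enum_rankK.
congr (\det _); apply/matrixP => i j; rewrite !mxE /h.
by case: splitP => i' _; rewrite !mxE; case: splitP => j' _; rewrite !mxE.
Qed.

(** The Schur complement formula.  The lower right block need not be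
invertible: a solution [Y] of the corresponding linear system is enough. *)
Lemma det_finmx_schur (A B : finType) (F : A + B -> A + B -> K) (Y : B -> A -> K) :
  (forall b a, \sum_b' F (inr b) (inr b') * Y b' a = F (inr b) (inl a)) ->
  \det (finmx F) =
  \det (finmx (fun a a' => F (inl a) (inl a') - \sum_b F (inl a) (inr b) * Y b a'))
  * \det (finmx (fun b b' => F (inr b) (inr b'))).
Proof.
move=> FY; rewrite det_finmx_sum.
set Mul := finmx _; set Mur := finmx _; set Mdl := finmx _; set Mdr := finmx _.
set S := finmx _.
have dr : Mdr *m finmx Y = Mdl.
  apply/matrixP => i j; rewrite !mxE -FY [RHS](reindex_onto enum_val enum_rank) /=.
    by under [RHS]eq_bigl do rewrite enum_valK eqxx; apply: eq_bigr => k _; rewrite !mxE.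
  by move=> b _; rewrite enum_rankK.
have ur : Mul - Mur *m finmx Y = S.
  apply/matrixP => i j; rewrite !mxE; congr (_ - _).
  rewrite [RHS](reindex_onto enum_val enum_rank) /=.
    by under [RHS]eq_bigl do rewrite enum_valK eqxx; apply: eq_bigr => k _; rewrite !mxE.
  by move=> b _; rewrite enum_rankK.
rewrite -(det_ublock S Mur Mdr).
(* Clear the lower left block by a unipotent column operation. *)
rewrite -[LHS]mulr1 -[X in _ * X](_ : \det (block_mx 1%:M 0 (- finmx Y) 1%:M) = 1).
  rewrite -det_mulmx mulmx_block !mulmx1 !mulmx0 !add0r !mulmxN dr subrr.
  by rewrite ur.
by rewrite det_lblock !det1 mulr1.
Qed.

Lemma det_finmx_void (A : finType) (F : A -> A -> K) : #|A| = 0%N -> \det (finmx F) = 1.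
Proof. by move=> A0; move: (finmx F); rewrite A0 => M; rewrite det_mx00. Qed.

(** The determinant of the Kronecker product of an identity matrix with [N]. *)
Lemma det_finmx_diag_block (E B : finType) (N : B -> B -> K) :
  \det (finmx (fun s t : E * B => if s.1 == t.1 then N s.2 t.2 else 0)) =
  \det (finmx N) ^+ #|E|.
Proof.
pose Nb (T : finType) (s t : T * B) := if s.1 == t.1 then N s.2 t.2 else 0.
have ordE m : \det (finmx (@Nb 'I_m)) = \det (finmx N) ^+ m.
  elim: m => [|m IH].
    by rewrite det_finmx_void // card_prod card_ord.
  pose h (s : B + 'I_m * B) : 'I_m.+1 * B :=
    match s with inl b => (ord0, b) | inr ib => (lift ord0 ib.1, ib.2) end.
  rewrite -(det_finmx_bij (h := h)); last first.
    exists (fun s : 'I_m.+1 * B => match unlift ord0 s.1 with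
      | Some i => inr (i, s.2) | None => inl s.2 end).
      by case=> [b|[i b]] /=; rewrite ?unlift_none ?liftK.
    by case=> i b /=; case: unliftP => [j ->|->].
  rewrite (det_finmx_schur (Y := fun _ _ => 0)).
    rewrite exprS; congr (_ * _).
      congr (\det _); apply: eq_finmx => a a' /=.
      by rewrite big1 ?subr0 // => b _; rewrite mulr0.
    (* Comparing lifted ordinals reduces to comparing the ordinals. *)
    by rewrite -IH; congr (\det _).
  by move=> [i b] a /=; rewrite big1 // => b' _; rewrite mulr0.
(* The induction is on ordinals; [E] is reindexed by its enumeration. *)
rewrite -(ordE #|E|) -[RHS](det_finmx_bij (h := fun s : E * B => (enum_rank s.1, s.2))).
  congr (\det _); apply: eq_finmx => s t /=.
  by rewrite /Nb /= (inj_eq enum_rank_inj).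
exists (fun s : 'I_#|E| * B => (enum_val s.1, s.2)) => -[i b] /=.
  by rewrite enum_rankK.
by rewrite enum_valK.
Qed.

End FinMatrix.

(** * Incidence and degrees in the central edge corona *)

Lemma deg_sum (G : sgraph) (v : G) : deg v = (\sum_w adj v w)%N.
Proof. by rewrite /deg -sum1dep_card big_mkcond; apply: eq_bigr => w _; case: adj. Qed.

Lemma edgesP (G : sgraph) (e : {set G}) :
  reflect (exists u v, adj u v /\ e = [set u; v]) (e \in edges G).
Proof.
rewrite inE; apply: (iffP existsP) => [[u /existsP[v /andP[uv /eqP->]]]|[u [v [uv ->]]]].
  by exists u, v.
by exists u; apply/existsP; exists v; rewrite uv eqxx.
Qed.

Lemma card_edge (G : sgraph) (e : {set G}) : e \in edges G -> #|e| = 2%N.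
Proof.
case/edgesP => u [v [uv ->]]; rewrite cards2; case: eqVneq => // euv.
by rewrite euv adj_irr in uv.
Qed.

Lemma edges_through (G : sgraph) (u : G) :
  [set e in edges G | u \in e] = [set [set u; w] | w in [set w | adj u w]].
Proof.
apply/setP => e; apply/setIdP/imsetP => [[/edgesP[a [b [ab ->]]]]|[w]].
  rewrite !inE => /orP[/eqP->|/eqP->]; first by exists b; rewrite ?inE.
  by exists a; rewrite ?inE 1?adj_sym // setUC.
rewrite inE => uw ->; rewrite !inE eqxx; split=> //.
by apply/existsP; exists u; apply/existsP; exists w; rewrite uw eqxx.
Qed.

(** The entries of [B B^T], where [B] is the vertex-edge incidence matrix. *)
Lemma sum_incidence (G : sgraph) (u v : G) :
  (\sum_(e : edge G) (u \in val e) * (v \in val e))%N =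
  if u == v then deg u else adj u v.
Proof.
rewrite -(big_sub (edges G) (fun e : {set G} => (u \in e) * (v \in e))%N).
transitivity (\sum_(e in [set e in edges G | u \in e]) (v \in e))%N.
  rewrite [RHS](eq_bigl (fun e => (e \in edges G) && (u \in e))); last first.
    by move=> e; rewrite inE.
  rewrite [RHS]big_mkcondr; apply: eq_bigr => e _.
  by case: (u \in e); rewrite ?mul1n.
rewrite edges_through big_imset /=; last first.
  move=> w w'; rewrite !inE => uw uw' /setP/(_ w).
  rewrite !inE eqxx orbT => /esym/orP[/eqP wu|/eqP //].
  by rewrite wu adj_irr in uw.
case: eqVneq => [<-|nuv].
  by rewrite /deg -sum1_card; apply: eq_bigr => w _; rewrite !inE eqxx.
under eq_bigl do rewrite inE.
rewrite big_mkcond (bigD1 v) //= big1 => [|w /negPf nwv].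
  by rewrite addn0 !inE eqxx orbT; case: adj.
by rewrite !inE eq_sym (negPf nuv) eq_sym nwv; case: adj.
Qed.

Lemma sum_incidence_edge (G : sgraph) (e : edge G) : (\sum_u (u \in val e) = 2)%N.
Proof.
rewrite -(card_edge (valP e)) -sum1_card [RHS]big_mkcond.
by apply: eq_bigr => u _; case: ifP.
Qed.

(** Every vertex of [G1] other than [u] gives exactly one neighbour of [u]:
itself if it is not adjacent to [u] in [G1], and otherwise the subdivision
vertex of the edge that joins them. *)
Lemma deg_central_vertex (G1 G2 : sgraph) (u : G1) :
  (deg (inl (inl u) : central_edge_corona G1 G2)).+1 = #|G1|.
Proof.
rewrite deg_sum big_sumType /= [X in (_ + X)%N]big1 ?addn0; last by case.
rewrite big_sumType /=.
have -> : (\sum_(e : edge G1) (u \in val e))%N = (\sum_v adj u v)%N.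
  rewrite -deg_sum; have := sum_incidence u u; rewrite eqxx => <-.
  by apply: eq_bigr => e _; rewrite mulnb andbb.
rewrite -big_split /= -[RHS]sum1_card (bigD1 u) //= adj_irr eqxx /=.
rewrite (bigD1 u (P := predT)) //= add0n add1n; congr _.+1; apply: eq_bigr => v nvu.
by rewrite eq_sym nvu; case: adj.
Qed.

Lemma deg_subdivision_vertex (G1 G2 : sgraph) (e : edge G1) :
  deg (inl (inr e) : central_edge_corona G1 G2) = (2 + #|G2|)%N.
Proof.
rewrite deg_sum big_sumType /= big_sumType /= [X in (_ + X + _)%N]big1 // addn0.
rewrite sum_incidence_edge; congr (_ + _)%N.
rewrite (eq_bigr (fun p : edge G1 * G2 => ((e == p.1) : nat))); last by case.
rewrite -(pair_bigA _ (fun f _ => (e == f) : nat)) /= exchange_big /= -[RHS]sum1_card.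
apply: eq_bigr => w _; rewrite (bigD1 e) //= eqxx big1 // => f.
by rewrite eq_sym => /negPf->.
Qed.

Lemma deg_copy_vertex (G1 G2 : sgraph) (e : edge G1) (v : G2) :
  deg (inr (e, v) : central_edge_corona G1 G2) = (deg v).+1.
Proof.
rewrite deg_sum big_sumType /= big_sumType /= big1 // add0n -add1n; congr (_ + _)%N.
  rewrite (bigD1 e) //= eqxx big1 // => f /negPf nef.
  by rewrite -[LHS]/(f == e : nat) nef.
rewrite (eq_bigr (fun p : edge G1 * G2 => ((e == p.1) && adj v p.2 : nat))); last by case.
rewrite -(pair_bigA _ (fun f w => (e == f) && adj v w : nat)) /= (bigD1 e) //=.
rewrite [X in (_ + X)%N]big1 ?addn0 => [|f].
  by rewrite deg_sum; apply: eq_bigr => w _; rewrite eqxx.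
by rewrite eq_sym => /negPf->; rewrite big1.
Qed.

(** * Elimination of the copies and of the subdivision vertices *)

Section CoronaDeterminant.
Variables (K : fieldType).

(** The entries of [x I - Q(G)]. *)
Definition charQ (x : K) (G : sgraph) (u v : G) : K :=
  (x - (deg u)%:R) *+ (u == v) - (adj u v)%:R.

(** The entries of the Schur complement left on the central graph after the
copies of [G2] are eliminated; [s] is the new diagonal entry of the subdivision
vertices. *)
Definition schur_central (x s : K) (G : sgraph) (a b : G + edge G) : K :=
  match a, b with
  | inl u, inl v => (x - #|G|%:R + 1) *+ (u == v) - ((u != v) && ~~ adj u v)%:R
  | inl u, inr e => - (u \in val e)%:R
  | inr e, inl u => - (u \in val e)%:R
  | inr e, inr f => s *+ (e == f)
  end.

Variables (x : K) (G1 G2 : sgraph).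

(** The vector [W] is a solution of [N W = 1], for [N = (x - 1) I - Q(G2)]; when
[N] is invertible its sum is the coronal. *)
Lemma det_eliminate_copies (W : G2 -> K) :
  (forall v, \sum_w charQ (x - 1) v w * W w = 1) ->
  \det (finmx (charQ x (G := central_edge_corona G1 G2))) =
  \det (finmx (schur_central x (x - #|G2|%:R - 2 - \sum_w W w) (G := G1))) *
  \det (finmx (charQ (x - 1) (G := G2))) ^+ #|{: edge G1}|.
Proof.
move=> charQ_W; set chi := \sum_w W w.
pose Y (b : edge G1 * G2) (a : G1 + edge G1) : K :=
  if a == inr b.1 then - W b.2 else 0.
have copyE e v f w : charQ x (inr (e, v) : central_edge_corona G1 G2) (inr (f, w)) =
    if e == f then charQ (x - 1) v w else 0.
  rewrite /charQ deg_copy_vertex /= -[inr (e, v) == inr (f, w)]/((e == f) && (v == w)).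
  case: (e == f) => /=; last by rewrite mulr0n subr0.
  by rewrite -natr1 opprD addrA addrAC.
have sum_pair (F : edge G1 * G2 -> K) e :
    (forall f w, f != e -> F (f, w) = 0) -> \sum_b F b = \sum_w F (e, w).
  move=> F0; transitivity (\sum_f \sum_w F (f, w)).
    by rewrite pair_bigA; apply: eq_bigr; case.
  rewrite (bigD1 e) //= [X in _ + X]big1 ?addr0 // => f nfe.
  by rewrite big1 // => w _; rewrite F0.
have linkE a e v : charQ x (inl a : central_edge_corona G1 G2) (inr (e, v)) =
    - (a == inr e)%:R by rewrite /charQ mulr0n sub0r.
have linkE' a e v : charQ x (inr (e, v) : central_edge_corona G1 G2) (inl a) =
    - (a == inr e)%:R by rewrite /charQ mulr0n sub0r.
rewrite (det_finmx_schur (Y := Y)) => [|[e v] a]; last first.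
  rewrite linkE' (sum_pair _ e) => [|f w /negPf nfe]; last first.
    by rewrite copyE eq_sym nfe mul0r.
  under eq_bigr do rewrite copyE eqxx /Y /=.
  case: eqP => _; last by rewrite oppr0 big1 // => w _; rewrite mulr0.
  by under eq_bigr do rewrite mulrN; rewrite sumrN charQ_W.
congr (_ * _); last first.
  rewrite -det_finmx_diag_block; congr (\det _); apply: eq_finmx => -[e v] [f w].
  by rewrite copyE.
congr (\det _); apply: eq_finmx => a a'.
have -> : \sum_b charQ x (inl a : central_edge_corona G1 G2) (inr b) * Y b a' =
    if a is inr e then chi *+ (a == a') else 0.
  case: a => [u|e].
    by rewrite big1 // => -[e v] _; rewrite linkE oppr0 mul0r.
  rewrite (sum_pair _ e) => [|f w /negPf nfe]; last first.
    by rewrite linkE -[inr e == inr f]/(e == f) eq_sym nfe oppr0 mul0r.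
  under eq_bigr do rewrite linkE eqxx /Y /=.
  rewrite eq_sym; case: eqP => _; last by rewrite big1 // => w _; rewrite mulr0.
  by under eq_bigr do rewrite mulrNN mul1r.
case: a a' => [u|e] [v|f]; rewrite /charQ /= ?subr0.
- have /(congr1 (fun n => n%:R : K)) := deg_central_vertex G2 u.
  rewrite -natr1 => <-; rewrite -[inl (inl u) == inl (inl v)]/(u == v).
  by congr (_ *+ _ - _); ring.
- by rewrite mulr0n sub0r.
- by rewrite !mulr0n sub0r.
- rewrite -[inl (inr e) == inl (inr f)]/(e == f) -[inr e == inr f]/(e == f).
  rewrite deg_subdivision_vertex -mulrnBl natrD; congr (_ *+ _); ring.
Qed.

Lemma det_eliminate_subdivision r s : regular r G1 -> s != 0 ->
  \det (finmx (schur_central x s (G := G1))) =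
  \det (finmx (fun u v : G1 => (x - #|G1|%:R + 2 - r%:R / s) *+ (u == v)
    + (1 - s^-1) * (adj u v)%:R - 1)) * s ^+ #|{: edge G1}|.
Proof.
move=> regG1 s0.
pose Y (e : edge G1) (u : G1) : K := - (u \in val e)%:R / s.
rewrite (det_finmx_schur (Y := Y)) => [|e u].
  congr (_ * _).
    congr (\det _); apply: eq_finmx => u v /=.
    have -> : \sum_(e : edge G1) - (u \in val e)%:R * (- (v \in val e)%:R / s) =
        (r%:R *+ (u == v) + (adj u v)%:R) / s.
      have := sum_incidence u v.
      move/(congr1 (fun n => n%:R : K)); rewrite natr_sum => inc.
      transitivity ((if u == v then deg u else adj u v)%:R / s).
        rewrite -inc mulr_suml; apply: eq_bigr => e _.
        by rewrite natrM mulrA mulrNN.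
      rewrite regG1; case: eqVneq => [<-|_]; last by rewrite mulr0n add0r.
      by rewrite adj_irr addr0.
    case: eqVneq => [<-|_] /=.
      by rewrite adj_irr /= !mulr1n !mulr0 !addr0 subr0; ring.
    by case: adj; rewrite /= !mulr0n; field.
  rewrite [finmx _](_ : _ = s%:M) ?det_scalar //.
  by apply/matrixP => i j; rewrite !mxE /= (inj_eq enum_val_inj).
rewrite /= (bigD1 e) //= eqxx mulr1n big1 ?addr0 => [|f /negPf nef].
  by rewrite mulrC divfK.
by rewrite eq_sym nef mulr0n mul0r.
Qed.

End CoronaDeterminant.

(** * Specialization to rational functions *)

HB.instance Definition _ (R : realType) :=
  GRing.RMorphism.copy (@const_ratfun R) (@tofrac {poly R} \o polyC).

Lemma signless_laplacian_sym (R : realType) (G : sgraph) :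
  (signless_laplacian R G)^T = signless_laplacian R G.
Proof. by rewrite linearD /= tr_diag_mx adjacency_mx_sym. Qed.

Lemma finmx_charQ (R : realType) (G : sgraph) (y : ratfun R) :
  finmx (charQ y (G := G)) =
  y%:M - map_mx (@const_ratfun R) (signless_laplacian R G).
Proof.
apply/matrixP => i j; rewrite !mxE /charQ (inj_eq enum_val_inj).
rewrite rmorphD !rmorphMn /= !rmorph1.
by rewrite opprD addrA -mulrnBl.
Qed.

Lemma tofrac_char_poly (R : realType) n (M : 'M[R]_n) :
  tofrac (char_poly M) = \det ((varX R)%:M - map_mx (@const_ratfun R) M).
Proof.
rewrite /char_poly -det_map_mx; congr (\det _); apply/matrixP => i j.
by rewrite !mxE rmorphB rmorphMn.
Qed.

Lemma det_charQ (R : realType) (G : sgraph) (y : ratfun R) :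
  \det (finmx (charQ y (G := G))) =
  \prod_(j < #|G|) (y - const_ratfun (eigenvalue_at (signless_laplacian R G) j)).
Proof.
have [S [d [uS eQ]]] := real_symmetric_diag (signless_laplacian_sym R G).
rewrite finmx_charQ eQ (prod_eigenvalues d (fun t => y - const_ratfun t) uS).
have := det_simultaneous_diag (@const_ratfun R) d d y (-1) 0 uS.
rewrite scale0r addr0 scaleN1r => ->.
by apply: eq_bigr => i _; rewrite mulN1r mul0r addr0.
Qed.

Lemma charQ_unit (R : realType) (G : sgraph) :
  finmx (charQ (varX R - 1) (G := G)) \in unitmx.
Proof.
rewrite unitmxE det_charQ unitfE; apply/prodf_neq0 => j _.
set t := eigenvalue_at _ _.
have -> : varX R - 1 - const_ratfun t = tofrac ('X - (1 + t)%:P).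
  by rewrite rmorphB /= rmorphD rmorphD /= !rmorph1 opprD addrA.
by rewrite tofrac_eq0 polyXsubC_eq0.
Qed.

(** The coronal is the sum of the entries of the solution [W] of
[(y I - Q) W = 1]. *)
Lemma coronal_weights (R : realType) (G : sgraph) (y : ratfun R) :
  finmx (charQ y (G := G)) \in unitmx ->
  exists2 W : G -> ratfun R, forall v, \sum_w charQ y v w * W w = 1 &
    coronal (signless_laplacian R G) y = \sum_w W w.
Proof.
set N := finmx _ => uN; pose C : 'cV_#|G| := invmx N *m const_mx 1.
have sum_enum (F : 'I_#|G| -> ratfun R) : \sum_i F i = \sum_w F (enum_rank w).
  rewrite (reindex_onto enum_rank enum_val) /=; last by move=> i _; rewrite enum_valK.
  by apply: eq_bigl => w; rewrite enum_rankK eqxx.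
exists (fun w => C (enum_rank w) 0) => [v|].
  transitivity ((N *m C) (enum_rank v) 0); last by rewrite mulKVmx // mxE.
  rewrite [RHS]mxE sum_enum; apply: eq_bigr => w _.
  by rewrite [N _ _]mxE !enum_rankK.
rewrite /coronal -finmx_charQ -/N -mulmxA -/C mxE sum_enum.
by apply: eq_bigr => w _; rewrite [const_mx _ _ _]mxE mul1r.
Qed.

(** This quantity times [\det ((x - 1) I - M)] is the characteristic polynomial
of the matrix [M + I] bordered by ones and the corner entry [k], hence
nonzero. *)
Lemma subdivision_entry_neq0 (R : realType) n (M : 'M[R]_n) (k : R) :
  (varX R - 1)%:M - map_mx (@const_ratfun R) M \in unitmx ->
  varX R - const_ratfun k - coronal M (varX R - 1) != 0.
Proof.
set N := _ - _; set s := _ - _ => uN.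
pose B : 'M[R]_(1 + n) := block_mx k%:M (const_mx 1) (const_mx 1) (M + 1%:M).
have : tofrac (char_poly B) != 0 by rewrite tofrac_eq0 monic_neq0 ?char_poly_monic.
rewrite tofrac_char_poly /B map_block_mx scalar_mx_block opp_block_mx add_block_mx.
rewrite !map_const_mx !add0r rmorph1 map_scalar_mx map_mxD map_mx1 -rmorphB /=.
have -> : (varX R)%:M - (map_mx (@const_ratfun R) M + 1%:M) = N.
  by rewrite /N [X in _ = X - _]rmorphB /= opprD addrA addrAC.
set u : 'rV_n := - const_mx 1; set v : 'cV_n := - const_mx 1.
apply: contraNneq => s0.
(* Clear the lower left block by a unipotent column operation; the upper left
   entry becomes [s]. *)
rewrite -[\det _]mulr1.
rewrite -[X in _ * X](_ : \det (block_mx 1%:M 0 (- invmx N *m v) 1%:M) = 1); last first.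
  by rewrite det_lblock !det1 mulr1.
rewrite -det_mulmx mulmx_block !mulmx1 !mulmx0 !add0r (mulNmx (invmx N)).
rewrite !(mulmxN _ (invmx N *m v)) mulKVmx // subrr.
rewrite det_ublock det_mx11 mulf_eq0; apply/orP; left; apply/eqP.
rewrite -[RHS]s0 /s /coronal -/N /u /v !mulmxN mulNmx !opprK mulmxA.
by rewrite !mxE eqxx mulr1n.
Qed.

(** The factor of one eigenvalue, with [t] the eigenvalue and [p] the value of
[P] at it, multiplied by [s = x - m - 2 - c]. *)
Lemma corona_factor (K : fieldType) (x n m r c t p : K) :
  x - m - 2 - c != 0 ->
  (x - n + 2) * (x - m - 2 - c) - r - (x - m - 2 - c) * p + (x - m - 3 - c) * t =
  (x - m - 2 - c) * (x - n + 2 - r / (x - m - 2 - c)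
    + (1 - (x - m - 2 - c)^-1) * t + (-1) * p).
Proof. by move=> s0; field. Qed.

(** * The signless Laplacian characteristic polynomial *)

Theorem theorem4p11 (R : realType) (G1 G2 : sgraph) (r1 n1 m1 n2 : nat)
    (hG1 : connected G1) (hG2 : connected G2) (hr1 : regular r1 G1)
    (hn1 : #|G1| = n1) (hm1 : #|edges G1| = m1) (hn2 : #|G2| = n2) :
  let x := varX R in
  let P := regular_poly R G1 r1 in
  let lambda := eigenvalue_at (adjacency_mx R G1) in
  let gamma := eigenvalue_at (signless_laplacian R G2) in
  let chi := coronal (signless_laplacian R G2) in
  tofrac (char_poly (signless_laplacian R (central_edge_corona G1 G2))) =
  (x - n2%:R - 2 - chi (x - 1)) ^ (m1%:Z - n1%:Z) *
  (\prod_(j < n2) (x - 1 - const_ratfun (gamma j)) ^+ m1) *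
  \prod_(i < n1)
    ((x - n1%:R + 2) * (x - n2%:R - 2 - chi (x - 1)) - r1%:R
     - (x - n2%:R - 2 - chi (x - 1)) * const_ratfun P.[lambda i]
     + (x - n2%:R - 3 - chi (x - 1)) * const_ratfun (lambda i)).
Proof.
move=> x P lambda gamma chi.
subst n1 m1 n2; pose s := x - #|G2|%:R - 2 - chi (x - 1).
have uN := charQ_unit R G2.
have s0 : s != 0.
  rewrite /s /chi.
  have := @subdivision_entry_neq0 R _ (signless_laplacian R G2) (#|G2|%:R + 2).
  by rewrite -finmx_charQ rmorphD !rmorph_nat opprD addrA => /(_ uN).
have [W WN chiE] := coronal_weights uN.
have -> : tofrac (char_poly (signless_laplacian R (central_edge_corona G1 G2))) =
    \det (finmx (charQ x (G := central_edge_corona G1 G2))).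
  by rewrite finmx_charQ tofrac_char_poly.
rewrite (det_eliminate_copies G1 WN) -chiE -/s.
rewrite (det_eliminate_subdivision x hr1 s0).
have [S [d [uS eA]]] := real_symmetric_diag (adjacency_mx_sym R G1).
(* [S] diagonalizes both [A] and the all-ones matrix [P(A)]. *)
have eJ := regular_poly_adjacency hG1 hr1 uS eA.
pose a := x - #|G1|%:R + 2 - r1%:R / s.
pose F t := a + (1 - s^-1) * const_ratfun t + (-1) * const_ratfun P.[t].
have -> : \det (finmx (fun u v : G1 => a *+ (u == v) + (1 - s^-1) * (adj u v)%:R - 1)) =
    \prod_(i < #|G1|) F (lambda i).
  rewrite /lambda eA (prod_eigenvalues d F uS).
  transitivity (\prod_i (a + (1 - s^-1) * const_ratfun (d 0 i)
      + (-1) * const_ratfun ((map_mx (horner P) d) 0 i))); last first.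
    by apply: eq_bigr => i _; rewrite mxE.
  rewrite -(det_simultaneous_diag (@const_ratfun R) _ _ _ _ _ uS) -eA eJ.
  congr (\det _); apply/matrixP => i j; rewrite !mxE (inj_eq enum_val_inj).
  by rewrite rmorph_nat rmorph1 mulN1r.
rewrite det_charQ card_sig -[RHS]mulrA [RHS]mulrCA [LHS]mulrC.
rewrite (eq_card (B := mem (edges G1))) // prodrXl; congr (_ * _).
rewrite [in RHS](eq_bigr (fun i : 'I_#|G1| => s * F (lambda i))) => [|i _]; last first.
  exact: corona_factor s0.
rewrite [in RHS]big_split /= prodr_const card_ord mulrA mulrC; congr (_ * _).
by rewrite (exprnP s #|G1|) -expfzDr // subrK.
Qed.
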